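(* Let $p$ be a prime and let $X$ be an affine simple latin cycle set of size $p^p$. Then $X$ is isomorphic to one of the following latin cycle sets: $$\mathrm{Aff}\big((\mathbb{Z}/p\mathbb{Z})^p,(\lambda I+\Delta)^{-1},A_\mu,(0,\ldots,0)\big),\qquad \mathrm{Aff}\big((\mathbb{Z}/p\mathbb{Z})^p,(\lambda I+\Delta)^{-1},A_1,(1,0,\ldots,0)\big),$$ for $\mu,\lambda=1,\ldots,p-1$. In particular, there are $p(p-1)$ affine simple latin cycle sets of size $p^p$ up to isomorphism.
   Context: A left quasigroup $(X,\cdot)$ is a non-empty set with a binary operation such that $\sigma_x:y\mapsto x\cdot y$ is bijective for every $x$; it is latin if moreover $y\mapsto y\cdot x$ is bijective for every $x$. A cycle set is a left quasigroup with $(x\cdot y)\cdot(x\cdot z)=(y\cdot x)\cdot(y\cdot z)$ for all $x,y,z$; all cycle sets are assumed non-degenerate, i.e. $x\mapsto x\cdot x$ is bijective. For an abelian group $(G,+)$, $\phi\in\mathrm{End}(G,+)$, $\psi\in\mathrm{Aut}(G,+)$, $c\in G$, $\mathrm{Aff}(G,\phi,\psi,c)$ denotes the left quasigroup on $G$ with $x\cdot y=\phi(x)+\psi(y)+c$; left quasigroups (isomorphic to ones) of this form are called affine. $X$ is indecomposable if $\mathcal{G}(X)=\langle\sigma_x\mid x\in X\rangle\le\mathrm{Sym}(X)$ is transitive. A congruence is an equivalence relation $\sim$ such that $x\sim x'$ and $y\sim y'$ imply $x\cdot y\sim x'\cdot y'$ and $\sigma_x^{-1}(y)\sim\sigma_{x'}^{-1}(y')$.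 $X$ is simple if it is indecomposable and its only congruences are the equality relation and the all relation. Matrices are $p\times p$ over $\mathbb{Z}/p\mathbb{Z}$ and act on column vectors. $I$ is the identity. $A_\mu$ is the matrix with entries $1$ in positions $(i+1,i)$ for $1\le i\le p-1$, entry $\mu$ in position $(1,p)$, and $0$ elsewhere. $\Delta$ is the matrix with entry $p-i$ in position $(i,i+1)$ for $1\le i\le p-1$ and $0$ elsewhere. *)

(* Defs.v *)
From HB Require Import structures.
From mathcomp Require Import all_boot all_order all_algebra all_fingroup.
From mathcomp Require Import zify.

Set Implicit Arguments.
Unset Strict Implicit.
Unset Printing Implicit Defensive.

Import GRing.Theory.
Local Open Scope ring_scope.

(* Only finite left quasigroups are considered here, so that the             *)
(* permutations sigma_x and the group they generate live in {perm X}.         *)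
Record leftQuasigroup := LeftQuasigroup {
  lq_sort :> finType;
  lq_op : lq_sort -> lq_sort -> lq_sort;
  lq_nonempty : inhabited lq_sort;
  lq_bij : forall x, bijective (lq_op x)
}.

Declare Scope lq_scope.
Delimit Scope lq_scope with lq.
Notation "x ⋅ y" := (lq_op x y) (at level 40, left associativity) : lq_scope.
Local Open Scope lq_scope.

Definition sigma (X : leftQuasigroup) (x : X) : {perm X} :=
  perm (bij_inj (lq_bij x)).

Definition latin (X : leftQuasigroup) : Prop :=
  forall x : X, bijective (fun y : X => y ⋅ x).

(* The second conjunct is non-degeneracy, part of the convention. *)
Definition cycle_set (X : leftQuasigroup) : Prop :=
  (forall x y z : X, (x ⋅ y) ⋅ (x ⋅ z) = (y ⋅ x) ⋅ (y ⋅ z)) /\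
  bijective (fun x : X => x ⋅ x).

Definition lmlt (X : leftQuasigroup) : {group {perm X}} :=
  <<[set sigma x | x : X]>>%G.

Definition indecomposable (X : leftQuasigroup) : Prop :=
  [transitive lmlt X, on [set: X] | 'P].

Definition congruence (X : leftQuasigroup) (R : rel X) : Prop :=
  [/\ equivalence_rel R,
      forall x x' y y' : X, R x x' -> R y y' -> R (x ⋅ y) (x' ⋅ y')
    & forall x x' y y' : X, R x x' -> R y y' ->
        R ((sigma x)^-1%g y) ((sigma x')^-1%g y')].

Definition simple_lq (X : leftQuasigroup) : Prop :=
  indecomposable X /\
  forall R : rel X, congruence R ->
    (forall x y, R x y = (x == y)) \/ (forall x y, R x y).

Definition isomorphic (X Y : leftQuasigroup) : Prop :=
  exists2 f : X -> Y, bijective f & forall x y : X, f (x ⋅ y) = f x ⋅ f y.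

Section Aff.
Variables (G : finZmodType) (phi psi : {additive G -> G}) (c : G).
Hypothesis psi_bij : bijective psi.

Definition aff_op (x y : G) : G := phi x + psi y + c.

Lemma aff_op_bij x : bijective (aff_op x).
Proof.
case: psi_bij => g gK Kg; exists (fun z => g (z - c - phi x)) => y.
  by rewrite /aff_op addrK addrAC subrr add0r gK.
by rewrite /aff_op Kg addrCA subrr addr0 subrK.
Qed.

Definition Aff : leftQuasigroup :=
  @LeftQuasigroup G aff_op (inhabits 0) aff_op_bij.

End Aff.

Definition affine (X : leftQuasigroup) : Prop :=
  exists (G : finZmodType) (phi psi : {additive G -> G}) (c : G)
         (psi_bij : bijective psi), isomorphic X (Aff phi c psi_bij).

(* Matrix indices start at 0, so position (i, j) on paper is (i-1, j-1). *)
Definition Amx (p : nat) (mu : 'F_p) : 'M['F_p]_p :=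
  \matrix_(i < p, j < p)
    if i == j.+1 :> nat then 1
    else if (i == 0 :> nat) && (j == p.-1 :> nat) then mu else 0.

Definition Deltamx (p : nat) : 'M['F_p]_p :=
  \matrix_(i < p, j < p) if j == i.+1 :> nat then (p - i.+1)%:R else 0.

Definition e1 (p : nat) : 'cV['F_p]_p :=
  \col_(i < p) (i == 0 :> nat)%:R.

Lemma Amx_bij (p : nat) (mu : 'F_p) :
  mu != 0 -> bijective (mulmx (Amx mu) : 'cV['F_p]_p -> 'cV['F_p]_p).
Proof.
move=> mu0.
pose B : 'M['F_p]_p := \matrix_(i, j)
  if j == i.+1 :> nat then 1
  else if (j == 0 :> nat) && (i == p.-1 :> nat) then mu^-1 else 0.
have AB : Amx mu *m B = 1%:M.
  apply/matrixP => i j; rewrite !mxE.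
  have ltip := ltn_ord i; have ltjp := ltn_ord j.
  have ltk : ((if i == 0 :> nat then p.-1 else i.-1) < p)%N.
    by case: eqP; lia.
  rewrite (bigD1 (Ordinal ltk)) //= big1 => [|k /eqP kn]; rewrite !mxE /=.
    rewrite addr0 -val_eqE /=.
    have [i0|i0] := eqVneq (i : nat) 0%N.
      rewrite i0 /= eqxx prednK; last by lia.
      rewrite (ltn_eqF ltjp) andbT [0%N == j]eq_sym.
      by case: ifP => _; rewrite ?mulr0 ?mulfV.
    have -> : (i : nat) = i.-1.+1 by lia.
    rewrite /= eqxx mul1r eq_sym; case: eqP => // ij.
    by rewrite ifN //; apply/negP => /andP[/eqP j0 /eqP ip]; lia.
  case: eqP => [ik | _].
    by case: kn; apply: val_inj => /=; rewrite ik.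
  case: andP => [[/eqP i0 /eqP kp] | _]; last by rewrite mul0r.
  by case: kn; apply: val_inj => /=; rewrite i0 kp.
have uA : Amx mu \in unitmx by case: (mulmx1_unit AB).
by exists (mulmx (invmx (Amx mu))) => v; [apply: mulKmx | apply: mulKVmx].
Qed.

Definition AffA (p : nat) (lambda mu : 'F_p) (mu0 : mu != 0)
    (c : 'cV['F_p]_p) : leftQuasigroup :=
  @Aff 'cV['F_p]_p (mulmx (invmx (lambda%:M + Deltamx p))) (mulmx (Amx mu)) c
    (Amx_bij mu0).
Arguments AffA {p} lambda mu mu0 c.

(* invmx above is a genuine inverse. *)
Lemma lambda_Delta_unit (p : nat) (lambda : 'F_p) :
  lambda != 0 -> lambda%:M + Deltamx p \in unitmx.
Proof.
move=> l0; rewrite unitmxE -det_tr det_trig.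
  rewrite unitfE; apply/prodf_neq0 => i _.
  by rewrite !mxE eqxx ifN ?addr0 //; lia.
apply/is_trig_mxP => i j lt_ij; rewrite !mxE ifN; last by lia.
by rewrite addr0 -val_eqE /= gtn_eqF.
Qed.

Definition affine_simple_latin_cycle_set (n : nat) (X : leftQuasigroup) :
    Prop :=
  [/\ affine X, simple_lq X, latin X, cycle_set X & #|X| = n].

Definition number_up_to_iso (P : leftQuasigroup -> Prop) (n : nat) : Prop :=
  exists F : 'I_n -> leftQuasigroup,
    [/\ forall i, P (F i),
        forall i j, isomorphic (F i) (F j) -> i = j
      & forall X, P X -> exists i, isomorphic X (F i)].

(* Main.v *)
Require Import Defs.
From HB Require Import structures.
From mathcomp Require Import all_boot all_order all_algebra all_fingroup.
From mathcomp Require Import cyclic pgroup abelian finfield mxabelem.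
From mathcomp Require Import zify ring.

Set Implicit Arguments.
Unset Strict Implicit.
Unset Printing Implicit Defensive.

Import GRing.Theory.
Local Open Scope ring_scope.

(* Put theta = phi^-1. The cycle set identity becomes psi theta - theta psi = 1,
   so G carries a representation of the Weyl algebra, and simplicity forces
   pG = 0, i.e. G = F_p^p. As [psi, q(theta)] = q'(theta) for each polynomial q,
   the minimal polynomial of theta has zero derivative, hence is X^p - lambda;
   likewise psi^p = mu. If v is an eigenvector of theta, then v, psi v, ...,
   psi^(p-1) v is a basis in which psi and theta are A_mu and lambda I + Delta.
   The constant only matters modulo the image of 1 - phi - psi, which is
   conjugate to 1 - A_mu: this is invertible unless mu = 1, where the cokernel
   is the line spanned by e1 and the scalars allow rescaling. Conversely, an
   isomorphism of latin affine left quasigroups is an affine map, so lambda and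
   mu are invariants, and for c = e1 there is no x with x . x = x. *)

(** * Matrices satisfying the Weyl relation in characteristic p *)

(** The commutator with [B] is a derivation sending [A] to 1; the Leibniz rule is applied along the
    Horner scheme of [q]. *)
Lemma commutator_horner_mx (R : comNzRingType) (n : nat) (A B : 'M[R]_n.+1)
    (q : {poly R}) :
  B * A - A * B = 1 ->
  B * horner_mx A q - horner_mx A q * B = horner_mx A q^`().
Proof.
move=> BA; elim/poly_ind: q => [|q c IHq].
  by rewrite deriv0 !rmorph0 mulr0 mul0r subrr.
rewrite derivMXaddC !rmorphD !rmorphM /= horner_mx_X horner_mx_C.
have cB : B * c%:M = c%:M * B := scalar_mxC c B.
rewrite mulrDr mulrDl cB opprD addrACA subrr addr0.
rewrite -[X in _ = X + _]mulr1 -BA -IHq mulrBr mulrBl !mulrA.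
by rewrite [RHS]addrC addrA subrK.
Qed.

(* In characteristic p, the derivative of the minimal polynomial of A
   annihilates A, hence vanishes, so this polynomial lies in F_p[X^p]. *)
Lemma mxminpoly_weyl (p n : nat) (A B : 'M['F_p]_n.+1) :
  prime p -> (n.+1 <= p)%N -> B * A - A * B = 1 ->
  exists a : 'F_p, mxminpoly A = 'X^p - a%:P.
Proof.
move=> p_pr le_np BA; set m := mxminpoly A.
have m0 : m != 0 by rewrite monic_neq0 // mxminpoly_monic.
have lt1m : (1 < size m)%N.
  by rewrite size_mxminpoly ltnS mxminpoly_nonconstant.
have lemp : (size m <= p.+1)%N.
  rewrite (leq_trans (dvdp_leq _ (mxminpoly_dvd_char A))) ?size_char_poly //.
  by rewrite monic_neq0 // char_poly_monic.
have m'0 : m^`() = 0.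
  apply/eqP/negPn/negP => m'n0; have : horner_mx A m^`() = 0.
    by rewrite -(commutator_horner_mx _ BA) mx_root_minpoly mulr0 mul0r subrr.
  move/mxminpoly_min/(dvdp_leq m'n0); rewrite leqNgt.
  by rewrite lt_size_deriv.
have p_ch := pchar_Fp p_pr.
have coefm i : (0 < i)%N -> (i < p)%N -> m`_i = 0.
  case: i => // i _ lt_ip; have /eqP := congr1 (fun q : {poly _} => q`_i) m'0.
  rewrite coef_deriv coef0 -mulr_natl mulf_eq0 -(dvdn_pcharf p_ch).
  by rewrite gtnNdvd //= => /eqP.
(* The coefficients in degrees 1 to p-1 vanish, so the nonconstant monic [m], of degree at most p,
   has degree exactly p. *)
have mp : m`_p = 1.
  have := mxminpoly_monic A; rewrite monicE /lead_coef -/m.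
  have [|le_pm] := ltnP (size m).-1 p; last first.
    move/eqP; have -> : (size m).-1 = p by lia.
    by [].
  by move=> lt_mp; rewrite coefm //; lia.
exists (- m`_0); apply/polyP => i; rewrite [RHS]coefB coefXn coefC.
have p0 := prime_gt0 p_pr.
have [->|i0] := eqVneq i 0%N; first by rewrite [0%N == p]ltn_eqF // opprK add0r.
rewrite subr0; have [->|ip] := eqVneq i p; first by rewrite mp.
have [lt_ip|] := ltnP i p; first by rewrite coefm // lt0n.
move=> le_pi; rewrite nth_default // (leq_trans lemp) //.
by rewrite ltn_neqAle eq_sym ip.
Qed.

(** The minimal polynomial X^p - a annihilates [A]. Iterates make the statement applicable at size
    [p], which is not syntactically a successor. *)
Lemma weyl_pow (p n : nat) (A B : 'M['F_p]_n) :
    prime p -> (0 < n <= p)%N -> B *m A - A *m B = 1%:M ->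
  exists a : 'F_p, forall x : 'cV_n, iter p (mulmx A) x = a *: x.
Proof.
case: n A B => // n A B p_pr le_np BA.
have [a m_def] := mxminpoly_weyl p_pr le_np BA; exists a => x.
have iterE k : iter k (mulmx A) x = A ^+ k *m x.
  by elim: k => [|k /= ->]; rewrite ?mul1mx // exprS mulmxA.
have := mx_root_minpoly A; rewrite m_def rmorphB rmorphXn /= horner_mx_X.
by rewrite horner_mx_C => /subr0_eq Ap; rewrite iterE Ap mul_scalar_mx.
Qed.

(** [eigenvalue] concerns row vectors, so the argument runs on transposes; [A^T] and [- B^T] again
    satisfy the Weyl relation. *)
Lemma weyl_eigenvector (p n : nat) (A B : 'M['F_p]_n) :
    prime p -> (0 < n <= p)%N -> B *m A - A *m B = 1%:M ->
  exists (a : 'F_p) (v : 'cV['F_p]_n), v != 0 /\ A *m v = a *: v.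
Proof.
case: n A B => // n A B p_pr le_np BA.
have BAt : - B^T * A^T - A^T * - B^T = 1.
  rewrite mulNr mulrN opprK addrC.
  by have := congr1 trmx BA; rewrite linearB /= !trmx_mul trmx1.
have [a m_def] := mxminpoly_weyl p_pr le_np BAt; exists a.
have /eigenvalueP[v vA v0] : eigenvalue A^T a.
  (* By Fermat a^p = a, so [a] itself is a root of X^p - a. *)
  rewrite eigenvalue_root_min m_def /root !hornerE.
  by have := expf_card a; rewrite card_Fp // => ->; rewrite subrr.
exists v^T; split; first by rewrite trmx_eq0.
by apply: trmx_inj; rewrite trmx_mul trmxK vA linearZ /= trmxK.
Qed.

(** This makes additive maps linear, and turns sets that contain 0 and are closed under addition
    into subspaces. *)
Lemma cV_Fp_scale (p m n : nat) (a : 'F_p) (x : 'M['F_p]_(m, n)) :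
  a *: x = x *+ a.
Proof. by rewrite -[in LHS](natr_Zp a) scaler_nat. Qed.

(** * The standard pair A_mu and Delta *)

Section Standard.
Variables (p : nat).
Hypothesis p_pr : prime p.
Implicit Types (lambda mu a : 'F_p) (x : 'cV['F_p]_p) (i j : 'I_p).

Let p_gt0 : (0 < p)%N := prime_gt0 p_pr.
Let p_ch : p \in [pchar 'F_p] := pchar_Fp p_pr.

Lemma natr_Fp_neq0 k : (0 < k)%N -> (k < p)%N -> k%:R != 0 :> 'F_p.
Proof. by move=> k0 kp; rewrite -(dvdn_pcharf p_ch) gtnNdvd. Qed.

Lemma Amx_mul_first mu x i j :
  i = 0%N :> nat -> j = p.-1 :> nat -> (Amx mu *m x) i 0 = mu * x j 0.
Proof.
move=> i0 jp; rewrite mxE (bigD1 j) //= big1 => [|k kn].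
  by rewrite addr0 mxE /= i0 jp !eqxx.
rewrite mxE i0 /= -jp; case: eqP => [kj|]; last by rewrite mul0r.
by case/eqP: kn; apply: val_inj.
Qed.

Lemma Amx_mulS mu x i j :
  i = j.+1 :> nat -> (Amx mu *m x) i 0 = x j 0.
Proof.
move=> ij; rewrite mxE (bigD1 j) //= big1 => [|k kn].
  by rewrite addr0 mxE /= ij eqxx mul1r.
rewrite mxE ij eqSS /=; case: eqP => [jk|]; last by rewrite mul0r.
by case/eqP: kn; apply: val_inj.
Qed.

Lemma Deltamx_mulS x i j :
  j = i.+1 :> nat -> (Deltamx p *m x) i 0 = - (j%:R * x j 0).
Proof.
move=> ji; rewrite mxE (bigD1 j) //= big1 => [|k kn].
  rewrite addr0 mxE ji eqxx natrB -?ji; last exact/ltnW.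
  by rewrite (pcharf0 p_ch) sub0r mulNr.
rewrite mxE -ji; case: eqP => [jk|]; last by rewrite mul0r.
by case/eqP: kn; apply: val_inj.
Qed.

Lemma Deltamx_mul_last x i : i.+1 = p -> (Deltamx p *m x) i 0 = 0.
Proof.
move=> ip; rewrite mxE big1 // => k _; rewrite mxE ip.
by rewrite (ltn_eqF (ltn_ord k)) mul0r.
Qed.

Lemma cV_ext m n (B C : 'M['F_p]_(m, n)) :
  (forall x : 'cV_n, B *m x = C *m x) -> B = C.
Proof.
move=> BC; apply/matrixP => i j.
by have /colP/(_ i) := BC (delta_mx j 0); rewrite -!colE !mxE.
Qed.

(** Reading the k-th standard column as X^k in F_p[X]/(X^p - mu), A_mu is multiplication by X and
    Delta is -d/dX. In coordinates, A_mu Delta and Delta A_mu multiply the i-th entry by -i and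
    -(i+1). *)
Lemma Amx_Delta_weyl lambda mu :
  Amx mu *m (lambda%:M + Deltamx p) - (lambda%:M + Deltamx p) *m Amx mu = 1%:M.
Proof.
rewrite mulmxDr mulmxDl scalar_mxC opprD addrACA subrr add0r.
apply: cV_ext => x; rewrite mul1mx mulmxBl -!mulmxA.
apply/colP => i; rewrite mxE [X in _ + X]mxE.
have ltip := ltn_ord i.
have -> : (Deltamx p *m (Amx mu *m x)) i 0 = - (i.+1%:R * x i 0).
  have [lt_i1p|le_pi1] := ltnP i.+1 p.
    rewrite (Deltamx_mulS _ (j := Ordinal lt_i1p)) //=.
    by rewrite (Amx_mulS _ _ (j := i)).
  (* The last row of Delta is zero, in accordance with the formula since i+1 = p vanishes in F_p. *)
  have ->: i.+1 = p by apply/eqP; rewrite eqn_leq ltip.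
  rewrite (pcharf0 p_ch) mul0r oppr0 Deltamx_mul_last //.
  by apply/eqP; rewrite eqn_leq ltip.
rewrite opprK.
have -> : (Amx mu *m (Deltamx p *m x)) i 0 = - (i%:R * x i 0).
  have [i0|i_gt0] := posnP i.
    have ltp1 : (p.-1 < p)%N by rewrite prednK.
    rewrite (Amx_mul_first _ _ i0 (j := Ordinal ltp1)) // Deltamx_mul_last.
      by rewrite i0 mulr0 mul0r oppr0.
    by rewrite /= prednK.
  have lti1 : (i.-1 < p)%N by rewrite (leq_ltn_trans (leq_pred i)).
  rewrite (Amx_mulS _ _ (j := Ordinal lti1)) /= ?prednK //.
  by rewrite (Deltamx_mulS _ (j := i)) //= prednK.
by rewrite -natr1 mulrDl mul1r addrA addNr add0r.
Qed.

(** The rows after the first say y_i - y_(i-1) = x_i, so y is [t] plus the partial sums of [x]; the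
    first row then becomes the condition on [t]. *)
Lemma Amx_solve mu x t :
  (1 - mu) * t = mu * \sum_i x i 0 -> exists y : 'cV_p, y - Amx mu *m y = x.
Proof.
move=> t_def; exists (\col_i (t + \sum_(j < p | (j <= i)%N) x j 0)).
apply/colP => i; rewrite mxE [X in _ + X]mxE.
have [i0|i_gt0] := posnP i.
  have ltp1 : (p.-1 < p)%N by rewrite prednK.
  rewrite (Amx_mul_first _ _ i0 (j := Ordinal ltp1)) // !mxE /=.
  rewrite [X in mu * (t + X)](_ : _ = \sum_i x i 0); last first.
    by apply: eq_bigl => j; rewrite -ltnS prednK // ltn_ord.
  rewrite (bigD1 i) //= big1 => [|j /andP[jli ji]].
    rewrite mulrDr -t_def; ring.
  by case/eqP: ji; apply: val_inj => /=; lia.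
have lti1 : (i.-1 < p)%N by rewrite (leq_ltn_trans (leq_pred i)).
rewrite (Amx_mulS _ _ (j := Ordinal lti1)) /= ?prednK // !mxE /=.
rewrite (bigD1 i) //= (eq_bigl (fun j : 'I_p => (j <= i.-1)%N)) => [|j].
  ring.
by rewrite -val_eqE /=; lia.
Qed.

(* e1 p is stdcol 0, and stdcol k = 0 when p <= k. *)
Definition stdcol (k : nat) : 'cV['F_p]_p := \col_(i < p) (i == k :> nat)%:R.

Lemma stdcol_neq0 : stdcol 0 != 0.
Proof.
apply/eqP => /colP/(_ (Ordinal p_gt0)); rewrite !mxE /= => /eqP.
by rewrite oner_eq0.
Qed.

Lemma col_stdcolE x : x = \sum_i x i 0 *: stdcol i.
Proof.
apply/colP => i; rewrite summxE (bigD1 i) //= big1 => [|j ji].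
  by rewrite !mxE eqxx mulr1 addr0.
by rewrite !mxE val_eqE eq_sym (negPf ji) mulr0.
Qed.

Lemma Amx_stdcol mu k : (k.+1 < p)%N -> Amx mu *m stdcol k = stdcol k.+1.
Proof.
move=> lt_k1p; apply/colP => i; have ltip := ltn_ord i.
have [i0|i_gt0] := posnP i.
  have ltp1 : (p.-1 < p)%N by rewrite prednK.
  rewrite (Amx_mul_first _ _ i0 (j := Ordinal ltp1)) // !mxE /= i0.
  by rewrite gtn_eqF ?mulr0 //; lia.
have lti1 : (i.-1 < p)%N by rewrite (leq_ltn_trans (leq_pred i)).
rewrite (Amx_mulS _ _ (j := Ordinal lti1)) /= ?prednK // !mxE /=.
by rewrite -eqSS prednK.
Qed.

Lemma Amx_stdcol_last mu : Amx mu *m stdcol p.-1 = mu *: stdcol 0.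
Proof.
apply/colP => i; have ltip := ltn_ord i.
have [i0|i_gt0] := posnP i.
  have ltp1 : (p.-1 < p)%N by rewrite prednK.
  by rewrite (Amx_mul_first _ _ i0 (j := Ordinal ltp1)) // !mxE /= i0 !eqxx.
have lti1 : (i.-1 < p)%N by rewrite (leq_ltn_trans (leq_pred i)).
rewrite (Amx_mulS _ _ (j := Ordinal lti1)) /= ?prednK // !mxE /=.
by rewrite ltn_eqF ?gtn_eqF ?mulr0 //; lia.
Qed.

Lemma iter_mulmx_sum (I : finType) (B : 'M['F_p]_p) (c : I -> 'F_p)
    (f : I -> 'cV['F_p]_p) k :
  iter k (mulmx B) (\sum_i c i *: f i) = \sum_i c i *: iter k (mulmx B) (f i).
Proof.
elim: k => // k IHk; rewrite iterS IHk mulmx_sumr; apply: eq_bigr => i _.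
by rewrite -scalemxAr.
Qed.

Lemma iter_Amx_stdcol mu k :
  (k < p)%N -> iter k (mulmx (Amx mu)) (stdcol 0) = stdcol k.
Proof.
by elim: k => // k IHk lt_kp; rewrite iterS IHk ?Amx_stdcol // ltnW.
Qed.

(** The iterates of [stdcol 0] form the standard basis, so going once around the cycle from
    [stdcol 0] suffices. *)
Lemma iter_Amx mu x : iter p (mulmx (Amx mu)) x = mu *: x.
Proof.
have iterp0 : iter p (mulmx (Amx mu)) (stdcol 0) = mu *: stdcol 0.
  rewrite -Amx_stdcol_last -(iter_Amx_stdcol mu (k := p.-1)) ?prednK //.
  by rewrite -iterS prednK.
have iterZ k a (y : 'cV_p) :
    iter k (mulmx (Amx mu)) (a *: y) = a *: iter k (mulmx (Amx mu)) y.
  by elim: k => // k IHk; rewrite !iterS IHk scalemxAr.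
rewrite [in LHS](col_stdcolE x) iter_mulmx_sum [in RHS](col_stdcolE x).
rewrite scaler_sumr; apply: eq_bigr => i _; rewrite scalerA [mu * _]mulrC.
rewrite -scalerA; congr (_ *: _).
rewrite -(iter_Amx_stdcol mu (ltn_ord i)) -iterD addnC iterD iterp0.
by rewrite iterZ.
Qed.

Lemma Deltamx_stdcol0 : Deltamx p *m stdcol 0 = 0.
Proof.
apply/colP => i; rewrite [RHS]mxE; have [lt_i1p|le_pi1] := ltnP i.+1 p.
  by rewrite (Deltamx_mulS _ (j := Ordinal lt_i1p)) //= !mxE /= mulr0 oppr0.
by rewrite Deltamx_mul_last //; apply/eqP; rewrite eqn_leq ltn_ord.
Qed.

(** Delta is nilpotent: the entries of [x] vanish one after the other, starting from the last. *)
Lemma Deltamx_eigen a x : a != 0 -> Deltamx p *m x = a *: x -> x = 0.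
Proof.
move=> a0 xa; suffices x0 k : forall i, (p <= i + k)%N -> x i 0 = 0.
  by apply/colP => i; rewrite mxE (x0 p) // leq_addl.
elim: k => [|k IHk] i; first by rewrite addn0 leqNgt ltn_ord.
move=> le_pik; apply/eqP; have /colP/(_ i)/eqP := xa; rewrite [X in _ == X]mxE.
have [lt_i1p|le_pi1] := ltnP i.+1 p.
  rewrite (Deltamx_mulS _ (j := Ordinal lt_i1p)) // IHk /=; last by lia.
  by rewrite mulr0 oppr0 eq_sym mulf_eq0 (negPf a0).
rewrite Deltamx_mul_last; last by apply/eqP; rewrite eqn_leq ltn_ord.
by rewrite eq_sym mulf_eq0 (negPf a0).
Qed.

(** Delta lowers the index of the last nonzero entry by one, so repeated application turns [w] into
    a nonzero multiple of [stdcol 0]. *)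
Lemma stdcol0_invariant (S : pred 'cV['F_p]_p) w :
  S 0 -> (forall x y, S x -> S y -> S (x + y)) ->
  (forall x, S x -> S (Deltamx p *m x)) ->
  S w -> w != 0 -> S (stdcol 0).
Proof.
move=> S0 SD SDelta Sw w0; suffices Sk k x :
    S x -> x != 0 -> (forall i, (k <= i)%N -> x i 0 = 0) -> S (stdcol 0).
  by apply: (Sk p w) => // i; rewrite leqNgt ltn_ord.
have SZ a y : S y -> S (a *: y).
  move=> Sy; rewrite cV_Fp_scale; elim: (a : nat) => // n IHn.
  by rewrite mulrS SD.
elim: k x => [|k IHk] x Sx x0 xk.
  by case/eqP: x0; apply/colP => i; rewrite mxE xk.
have [lt_kp|le_pk] := ltnP k p; last first.
  apply: (IHk x) => // i le_ki; have := leq_trans le_pk le_ki.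
  by rewrite leqNgt ltn_ord.
pose ko := Ordinal lt_kp.
have [xk0|xkn0] := eqVneq (x ko 0) 0.
  apply: (IHk x) => // i; rewrite leq_eqVlt => /orP[/eqP ki|/xk//].
  by rewrite -xk0; congr (x _ 0); apply: val_inj.
have [k0|k_gt0] := posnP k.
  suffices -> : stdcol 0 = (x ko 0)^-1 *: x by apply: SZ.
  apply/colP => i; rewrite !mxE; have [i0|i_gt0] := posnP i.
    rewrite (_ : i = ko) ?mulVf ?k0 ?i0 //.
    by apply: val_inj; rewrite /= k0 i0.
  by rewrite (xk i) ?mulr0 ?(gtn_eqF i_gt0) // k0.
have ltk1 : (k.-1 < p)%N by rewrite (leq_ltn_trans (leq_pred k)).
(* Entry k-1 of the new vector is -k x_k, which is nonzero because 0 < k < p. *)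
apply: (IHk (Deltamx p *m x)); first exact: SDelta.
  apply/eqP => /colP/(_ (Ordinal ltk1))/eqP.
  rewrite (Deltamx_mulS _ (j := ko)) /= ?prednK // mxE oppr_eq0 mulf_eq0.
  by rewrite (negPf (natr_Fp_neq0 k_gt0 lt_kp)) (negPf xkn0).
move=> i le_ki; have [lt_i1p|le_pi1] := ltnP i.+1 p.
  by rewrite (Deltamx_mulS _ (j := Ordinal lt_i1p)) // xk ?mulr0 ?oppr0.
by rewrite Deltamx_mul_last //; apply/eqP; rewrite eqn_leq ltn_ord.
Qed.

(** Irreducibility of the representation: Delta leads down to [stdcol 0], from which A_mu climbs
    through the whole basis. *)
Lemma invariant_full mu (S : pred 'cV['F_p]_p) w :
  S 0 -> (forall x y, S x -> S y -> S (x + y)) ->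
  (forall x, S x -> S (Deltamx p *m x)) ->
  (forall x, S x -> S (Amx mu *m x)) ->
  S w -> w != 0 -> forall x, S x.
Proof.
move=> S0 SD SDelta SA Sw w0 x.
have Se k : (k < p)%N -> S (stdcol k).
  elim: k => [_|k IHk lt_kp]; first exact: (stdcol0_invariant (w := w)).
  by rewrite -(Amx_stdcol mu lt_kp) SA // IHk // ltnW.
rewrite (col_stdcolE x); elim/big_ind: _ => // i _.
rewrite cV_Fp_scale; elim: (x i 0 : nat) => // n IHn.
by rewrite mulrS SD // Se.
Qed.

End Standard.

(** * Finiteness, and transport of properties along isomorphisms *)

(** On a finite type the inverse of [h] acts on each point as an iterate of [h]. *)
Lemma injective_preim_closed (T : finType) (h : T -> T) (P : pred T) :
  injective h -> (forall x, P x -> P (h x)) -> forall x, P (h x) -> P x.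
Proof.
move=> h_inj hP x Phx; rewrite -(finv_f h_inj x) /finv.
by elim: (fingraph.order h (h x)).-1 => //= n; apply: hP.
Qed.

Lemma isomorphic_sym X Y : isomorphic X Y -> isomorphic Y X.
Proof.
case=> f [g fK gK] fM; exists g => [|x y]; first by exists f.
by rewrite -{1}(gK x) -{1}(gK y) -fM fK.
Qed.

Lemma isomorphic_trans X Y Z :
  isomorphic X Y -> isomorphic Y Z -> isomorphic X Z.
Proof.
case=> f f_bij fM [g g_bij gM]; exists (g \o f); first exact: bij_comp.
by move=> x y; rewrite /= fM gM.
Qed.

Lemma isomorphic_latin X Y : isomorphic X Y -> latin X -> latin Y.
Proof.
case=> f [g fK gK] fM latX x; apply: injF_bij => y z /(congr1 g).
rewrite -(gK x) -(gK y) -(gK z) -!fM !fK.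
by move/(bij_inj (latX (g x))) ->.
Qed.

Lemma isomorphic_cycle_set X Y : isomorphic X Y -> cycle_set X -> cycle_set Y.
Proof.
case=> f [g fK gK] fM [cycX sqX]; split=> [x y z|].
  by rewrite -(gK x) -(gK y) -(gK z) -!fM cycX.
apply: injF_bij => x y /(congr1 g).
by rewrite -(gK x) -(gK y) -!fM !fK => /(bij_inj sqX) ->.
Qed.

Lemma isomorphic_congruence (X Y : leftQuasigroup) (R : rel Y) :
  isomorphic X Y -> simple_lq X -> congruence R ->
  (forall x y, R x y = (x == y)) \/ (forall x y, R x y).
Proof.
case=> f [g fK gK] fM [_ simX] [Req Rop Rinv].
have fV x y : f ((sigma x)^-1%g y) = (sigma (f x))^-1%g (f y).
  apply: (canRL (permK _)); rewrite permE -fM.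
  by have := permKV (sigma x) y; rewrite permE => ->.
have [|Rid|Rall] := simX (fun x y => R (f x) (f y)).
- split=> [x y z|x x' y y' Rx Ry|x x' y y' Rx Ry]; first exact: Req.
    by rewrite !fM Rop.
  by rewrite !fV Rinv.
- by left=> x y; rewrite -(gK x) -(gK y) Rid (can_eq fK).
- by right=> x y; rewrite -(gK x) -(gK y) Rall.
Qed.

(** Right division provides a single translation [sigma] taking the base point to any given
    point. *)
Lemma latin_indecomposable X : latin X -> indecomposable X.
Proof.
case: (lq_nonempty X) => x0 latX; apply/imsetP; exists x0 => //.
apply/setP => y; rewrite inE; apply/esym/orbitP.
have [g _ gK] := latX x0; exists (sigma (g y)).
  by apply: mem_gen; apply: imset_f.
by rewrite /= /aperm permE gK.
Qed.

(** * Cycle set identity and congruences of affine left quasigroups *)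

Section AffTheory.
Variables (G : finZmodType) (phi psi : {additive G -> G}) (c : G).
Hypothesis psi_bij : bijective psi.
Local Notation X := (Aff phi c psi_bij).

Lemma Aff_opE (x y : G) : lq_op (x : X) (y : X) = phi x + psi y + c.
Proof. by []. Qed.

Lemma Aff_latin : injective phi -> latin X.
Proof.
move=> phi_inj x; apply: injF_bij => y z.
by rewrite !Aff_opE => /addIr/addIr/phi_inj.
Qed.

Lemma Aff_latin_inj : latin X -> injective phi.
Proof.
move=> latX x y xy; apply: (bij_inj (latX 0)).
by rewrite !Aff_opE xy.
Qed.

(** The hypothesis on [phi] and [psi] is the Weyl relation psi theta - theta psi = 1 for theta =
    phi^-1; it makes the expansion of (x.y).(x.z) symmetric in x and y. *)
Lemma Aff_cycle_set :
    injective phi ->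
    (forall x, phi (psi x) = psi (phi x) + phi (phi x)) ->
  cycle_set X.
Proof.
move=> phi_inj phipsi; split=> [x y z|].
  rewrite !Aff_opE !raddfD /= !phipsi !addrA.
  by rewrite [LHS](ACl (3 * 5 * 1 * 4 * 2 * 6 * 7 * 8)%AC).
have [g gK Kg] := injF_bij phi_inj.
apply: injF_bij => x y; rewrite !Aff_opE => /addIr.
(* Squaring has linear part phi + psi, and (phi + psi) phi = phi psi is injective. *)
rewrite -(Kg x) -(Kg y) !(addrC (phi (phi _))) -!phipsi.
by move/phi_inj/(bij_inj psi_bij) ->.
Qed.

Lemma Aff_cycle_set_comm :
  cycle_set X -> forall x, phi (psi x) = psi (phi x) + phi (phi x).
Proof.
case=> cycX _ x; have := cycX x 0 0; rewrite !Aff_opE !raddfD !raddf0 /=.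
rewrite !(add0r, addr0) => /addIr; rewrite !addrA => /addIr.
by rewrite addrAC => /addIr <-; rewrite addrC.
Qed.

Section Congruence.
Variable R : rel X.
Hypothesis congR : congruence R.

Let Rrefl x : R x x.
Proof. by case: congR => eqR _ _; have [] := eqR x x x. Qed.

Hypothesis phi_inj : injective phi.

(* R relates phi x + a and phi y + a for each a; since phi has finite order,
   iterating this cancels phi. *)
Lemma Aff_congruence_translate (x y a : G) : R x y -> R (x + a) (y + a).
Proof.
have [eqR Rop _] := congR; have [psi' _ psi'K] := psi_bij.
pose h (u : G * G) := (phi u.1, phi u.2).
pose P (u : G * G) := [forall a : G, R (u.1 + a) (u.2 + a)].
have PhR (u : G * G) : R u.1 u.2 -> P (h u).
  move=> Ru; apply/forallP => b; have := Rop _ _ _ _ Ru (Rrefl (psi' (b - c))).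
  by rewrite !Aff_opE psi'K -!addrA addNr addr0.
move=> Rxy; suffices /forallP : P (x, y) by apply.
apply: (injective_preim_closed (h := h)) (PhR (x, y) Rxy).
  by move=> [u v] [u' v'] [/phi_inj-> /phi_inj->].
by move=> u /forallP/(_ 0); rewrite !addr0 => /PhR.
Qed.

(** Reduces [R] to the class of 0, which the next lemmas show to be closed under addition, [phi] and
    [psi]. *)
Lemma Aff_congruence_sub (x y : G) : R x y = R (x - y) 0.
Proof.
apply/idP/idP => /Aff_congruence_translate; first move/(_ (- y)); last first.
  by move/(_ y); rewrite subrK add0r.
by rewrite subrr.
Qed.

Lemma Aff_congruence_add (x y : G) : R x 0 -> R y 0 -> R (x + y) 0.
Proof.
have [eqR _ _] := congR; move=> Rx Ry.
have [_ Rtr] := eqR (x + y) y 0.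
by rewrite Rtr //; have := Aff_congruence_translate y Rx; rewrite add0r.
Qed.

Lemma Aff_congruence_phi (x : G) : R x 0 -> R (phi x) 0.
Proof.
have [_ Rop _] := congR; move=> Rx; have := Rop _ _ _ _ Rx (Rrefl 0).
move/(Aff_congruence_translate (- c)).
by rewrite !Aff_opE !raddf0 !addr0 add0r addrK subrr.
Qed.

Lemma Aff_congruence_psi (x : G) : R x 0 -> R (psi x) 0.
Proof.
have [_ Rop _] := congR; move=> Rx; have := Rop _ _ _ _ (Rrefl 0) Rx.
move/(Aff_congruence_translate (- c)).
by rewrite !Aff_opE !raddf0 !addr0 !add0r addrK subrr.
Qed.

End Congruence.

(** Having equal multiples by p is a congruence. If it is equality, multiplication by p^p is
    injective as well, yet it kills [G] by Lagrange, so [G] would be trivial. *)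
Lemma Aff_simple_exponent p :
    (1 < #|G|)%N -> #|G| = (p ^ p)%N ->
    (forall R : rel X, congruence R ->
       (forall x y, R x y = (x == y)) \/ (forall x y, R x y)) ->
  forall x : G, x *+ p = 0.
Proof.
move=> G1 oG simX x.
have [|Rid|Rall] := simX (fun x y : G => x *+ p == y *+ p); last 2 first.
- have inj k (y : G) : y *+ (p ^ k) = 0 -> y = 0.
    elim: k y => [|k IHk] y; first by rewrite expn0 mulr1n.
    rewrite expnSr mulrnA => yp; apply: IHk; apply/eqP.
    by rewrite -Rid yp mul0rn.
  have all0 (y : G) : y = 0.
    apply: (inj p); rewrite -oG -cardsT -FinRing.zmodXgE.
    exact: (expg_cardG (G := [set: G]%G) (in_setT y)).
  by move: G1; rewrite (eq_card1 (x := 0)) // => y; rewrite !inE (all0 y) eqxx.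
- by apply/eqP; have := Rall x 0; rewrite mul0rn.
split=> [|u u' v v' /eqP Ru /eqP Rv|u u' v v' /eqP Ru /eqP Rv].
- by move=> u v w; split=> // /eqP ->.
- by rewrite !Aff_opE !mulrnDl -!raddfMn /= Ru Rv.
have sV w z : psi ((sigma (w : X))^-1%g (z : X)) = z - c - phi w.
  have := permKV (sigma (w : X)) z; rewrite permE Aff_opE.
  by move: (psi _) => t <-; rewrite addrK addrAC subrr add0r.
apply/eqP; apply: (bij_inj psi_bij); rewrite !raddfMn !sV !mulrnBl.
by rewrite -!(raddfMn phi) Ru Rv.
Qed.

End AffTheory.

(** * Isomorphisms between affine left quasigroups *)

Section AffMaps.
Variables (G H : finZmodType).
Variables (phi psi : {additive G -> G}) (c : G) (psi_bij : bijective psi).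
Variables (phi' psi' : {additive H -> H}) (c' : H) (psi'_bij : bijective psi').

Lemma Aff_isomorphic (h : G -> H) (w : H) :
    bijective h -> {morph h : x y / x + y} ->
    (forall x, h (phi x) = phi' (h x)) -> (forall x, h (psi x) = psi' (h x)) ->
    h c + w = phi' w + psi' w + c' ->
  isomorphic (Aff phi c psi_bij) (Aff phi' c' psi'_bij).
Proof.
move=> h_bij hD hphi hpsi hc; exists (fun x : G => h x + w) => [|x y].
  case: h_bij => g hK gK; exists (fun z => g (z - w)) => z.
    by rewrite addrK hK.
  by rewrite gK subrK.
rewrite !Aff_opE !hD hphi hpsi !raddfD /= -addrA hc !addrA.
by rewrite [LHS](ACl (1 * 3 * 2 * 4 * 5)%AC).
Qed.

(* A homomorphism f satisfies f(u + v + c) = g(u) + h(v) for some functions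
   g and h, which forces x |-> f(x + c) - f(c) to be additive. *)
Lemma Aff_isomorphic_additive :
    injective phi -> isomorphic (Aff phi c psi_bij) (Aff phi' c' psi'_bij) ->
  exists h : G -> H,
    [/\ bijective h, {morph h : x y / x + y},
        forall x, h (phi x) = phi' (h x) & forall x, h (psi x) = psi' (h x)].
Proof.
move=> phi_inj [f [g fK gK] fM]; pose h (x : G) : H := f (x + c) - f c.
have [phiV _ phiK] := injF_bij phi_inj; have [psiV _ psiK] := psi_bij.
have fE (x y : G) : f (phi x + psi y + c) = phi' (f x) + psi' (f y) + c'.
  exact: fM x y.
have f_phi x : f (phi x + c) = phi' (f x) + psi' (f 0) + c'.
  by rewrite -fE raddf0 addr0.
have f_psi y : f (psi y + c) = phi' (f 0) + psi' (f y) + c'.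
  by rewrite -fE raddf0 add0r.
have f_c : f c = phi' (f 0) + psi' (f 0) + c'.
  by rewrite -fE !raddf0 !add0r.
have h_phi x : h (phi x) = phi' (f x - f 0).
  rewrite /h f_phi f_c raddfB /=.
  by do 2!rewrite opprD addrACA subrr addr0.
have h_psi x : h (psi x) = psi' (f x - f 0).
  rewrite /h f_psi f_c raddfB /= opprD addrACA subrr addr0.
  by rewrite opprD addrACA subrr add0r.
have hD : {morph h : x y / x + y}.
  move=> x y; rewrite -(phiK x) -(psiK y) h_phi h_psi /h fE f_c !raddfB /=.
  by rewrite opprD addrACA subrr addr0 opprD addrACA.
have hE x : h x = f x - f 0.
  (* Additivity gives h(x) + h(-c) = h(x - c) = f(x) - f(c), while h(-c) = f(0) - f(c). *)
  apply: (addIr (h (- c))); rewrite -hD /h addrNK addNr.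
  by rewrite addrA subrK.
exists h; split=> // [|x|x]; last 2 first.
- by rewrite h_phi hE.
- by rewrite h_psi hE.
exists (fun z => g (z + f 0)) => x; first by rewrite hE subrK fK.
by rewrite hE gK addrK.
Qed.

End AffMaps.

(** * Coordinates over F_p *)

Lemma elementary_abelian_coordinates (G : finZmodType) (p n : nat) :
    prime p -> #|G| = (p ^ n)%N -> (forall x : G, x *+ p = 0) ->
  exists g : 'cV['F_p]_n -> G, bijective g /\ {morph g : x y / x + y}.
Proof.
move=> p_pr oG pG.
have abV : (p.-abelem [set: 'cV['F_p]_n])%g := mx_Fp_abelem n 1 p_pr.
have abG : (p.-abelem [set: G])%g.
  rewrite abelemE // FinRing.zmod_abelian; apply/exponentP => x _.
  by rewrite FinRing.zmodXgE pG.
have /isogP[g g_inj im_g] : ([set: 'cV['F_p]_n] \isog [set: G])%g.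
  rewrite (isog_abelem_card _ abV) abG !cardsT oG card_mx muln1 card_Fp //=.
exists g; split; last by move=> x y; have := morphM g (in_setT x) (in_setT y).
apply: inj_card_bij => [x y|]; first exact: (injmP g_inj).
by rewrite oG card_mx muln1 card_Fp.
Qed.

Lemma additive_mx (p n : nat) (h : 'cV['F_p]_n -> 'cV['F_p]_n) :
  {morph h : x y / x + y} -> exists M : 'M['F_p]_n, forall x, h x = M *m x.
Proof.
move=> hD; exists (\matrix_(i, j) h (delta_mx j 0) i 0) => x.
have h0 : h 0 = 0 by apply: (addIr (h 0)); rewrite -hD !add0r.
have hZ a y : h (a *: y) = a *: h y.
  rewrite !cV_Fp_scale; elim: (a : nat) => [|k IHk]; first by rewrite !mulr0n.
  by rewrite !mulrS hD IHk.
rewrite [in LHS](matrix_sum_delta x) exchange_big big_ord1 (big_morph h hD h0).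
apply/colP => i; rewrite summxE mxE; apply: eq_bigr => j _.
by rewrite hZ !mxE mulrC.
Qed.

(** * Normal form of a pair satisfying the Weyl relation *)

Section NormalForm.
Variables (p : nat).
Hypothesis p_pr : prime p.
Let p_gt0 : (0 < p)%N := prime_gt0 p_pr.

Lemma Deltamx_stdcolS k :
  (k.+1 < p)%N -> Deltamx p *m stdcol p k.+1 = - (k.+1%:R *: stdcol p k).
Proof.
move=> lt_k1p; apply/colP => i; rewrite [RHS]mxE [X in _ = - X]mxE.
have [lt_i1p|le_pi1] := ltnP i.+1 p.
  rewrite (Deltamx_mulS p_pr _ (j := Ordinal lt_i1p)) // !mxE /= eqSS.
  by case: eqP => [->|]; rewrite ?mulr0.
rewrite Deltamx_mul_last; last by apply/eqP; rewrite eqn_leq ltn_ord.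
by rewrite mxE gtn_eqF ?mulr0 ?oppr0 //; lia.
Qed.

Lemma stdcol_ext m (B C : 'M['F_p]_(m, p)) :
  (forall k, (k < p)%N -> B *m stdcol p k = C *m stdcol p k) -> B = C.
Proof.
move=> BC; apply: cV_ext => x; rewrite (col_stdcolE x) !mulmx_sumr.
by apply: eq_bigr => i _; rewrite -!scalemxAr BC.
Qed.

(** Moving [T] past each factor [U] costs one term, as TU = UT - 1. At k = 0 the truncated [k.-1] is
    harmless: its coefficient is 0. *)
Lemma iter_weyl (T U : 'M['F_p]_p) (a : 'F_p) (v : 'cV['F_p]_p) k :
    U *m T - T *m U = 1%:M -> T *m v = a *: v ->
  T *m iter k (mulmx U) v =
    a *: iter k (mulmx U) v - k%:R *: iter k.-1 (mulmx U) v.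
Proof.
move=> UT Tv; elim: k => [|k IHk]; first by rewrite scale0r subr0.
have TU x : T *m (U *m x) = U *m (T *m x) - x.
  by rewrite -[X in _ = _ - X]mul1mx -UT mulmxBl !mulmxA opprB addrC subrK.
rewrite iterS TU IHk mulmxBr -!scalemxAr -addrA; congr (_ + _).
rewrite -opprD -[k.+1%:R]natr1 scalerDl scale1r /=.
by case: k {IHk} => [|k //]; rewrite !scale0r.
Qed.

(** The columns of P are v, U v, ..., U^(p-1) v for an eigenvector v of [T]; the relation U^p = mu
    closes the cycle. *)
Lemma weyl_normal_form (T U : 'M['F_p]_p) :
    (forall x : 'cV_p, T *m x = 0 -> x = 0) ->
    (forall x : 'cV_p, U *m x = 0 -> x = 0) ->
    U *m T - T *m U = 1%:M ->
  exists (lambda mu : 'F_p) (P : 'M['F_p]_p),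
    [/\ lambda != 0, mu != 0, forall x : 'cV_p, P *m x = 0 -> x = 0,
        T *m P = P *m (lambda%:M + Deltamx p) & U *m P = P *m Amx mu].
Proof.
move=> T_inj U_inj UT; have p_bnd : (0 < p <= p)%N by rewrite p_gt0 leqnn.
have [lambda [v [v0 Tv]]] := weyl_eigenvector p_pr p_bnd UT.
have [mu Up] : exists a : 'F_p, forall x : 'cV_p, iter p (mulmx U) x = a *: x.
  (* The Weyl relation is preserved when (T, U) is replaced by (U, -T). *)
  apply: (weyl_pow (B := - T)) => //.
  by rewrite mulNmx mulmxN opprK addrC.
pose P : 'M['F_p]_p := \matrix_(i, j) iter j (mulmx U) v i 0.
have PE k : (k < p)%N -> P *m stdcol p k = iter k (mulmx U) v.
  move=> lt_kp; apply/colP => i; rewrite mxE (bigD1 (Ordinal lt_kp)) //=.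
  rewrite big1 => [|j jk]; first by rewrite !mxE /= eqxx mulr1 addr0.
  by move: jk; rewrite -val_eqE /= !mxE => /negPf->; rewrite mulr0.
have TP : T *m P = P *m (lambda%:M + Deltamx p).
  apply: stdcol_ext => k lt_kp; rewrite -!mulmxA PE // (iter_weyl _ UT Tv).
  rewrite mulmxDl mul_scalar_mx mulmxDr -scalemxAr PE //; congr (_ + _).
  case: k lt_kp => [|k] lt_kp.
    by rewrite Deltamx_stdcol0 // mulmx0 scale0r oppr0.
  by rewrite Deltamx_stdcolS // mulmxN -scalemxAr PE // ltnW.
have UP : U *m P = P *m Amx mu.
  apply: stdcol_ext => k lt_kp; rewrite -!mulmxA PE // -iterS.
  have [lt_k1p|le_pk1] := ltnP k.+1 p; first by rewrite (Amx_stdcol p_pr) // PE.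
  have k1p : k.+1 = p by apply/eqP; rewrite eqn_leq lt_kp.
  rewrite k1p Up (_ : k = p.-1); last by rewrite -[in RHS]k1p.
  by rewrite (Amx_stdcol_last p_pr) -scalemxAr PE.
have U_iter k : iter k (mulmx U) v != 0.
  by elim: k => // k IHk; apply/eqP => /U_inj/eqP; apply/negP.
exists lambda, mu, P; split=> //.
- by apply: contra_neq v0 => l0; apply: T_inj; rewrite Tv l0 scale0r.
- by apply: contraNneq (U_iter p) => mu0; rewrite Up mu0 scale0r.
(* The kernel of [P] is stable under Delta, so if nonzero it would contain [stdcol 0], whose image
   is v. *)
move=> w Pw; apply/eqP/negPn/negP => w0.
case/eqP: v0; rewrite -[v]/(iter 0 (mulmx U) v) -PE //; apply/eqP.
apply: (stdcol0_invariant p_pr (S := fun x => P *m x == 0) (w := w)) => //.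
- by rewrite mulmx0.
- by move=> x y /eqP Px /eqP Py; rewrite mulmxDr Px Py addr0.
- move=> x /eqP Px; have : P *m ((lambda%:M + Deltamx p) *m x) = 0.
    by rewrite mulmxA -TP -mulmxA Px mulmx0.
  by rewrite mulmxDl mul_scalar_mx mulmxDr -scalemxAr Px scaler0 add0r => ->.
by rewrite Pw.
Qed.

End NormalForm.

(** * The models [AffA]: simplicity, constants and invariants *)

Section AffA.
Variables (p : nat).
Hypothesis p_pr : prime p.
Implicit Types (lambda mu : 'F_p) (c x y : 'cV['F_p]_p).
Let p_gt0 : (0 < p)%N := prime_gt0 p_pr.

Lemma invmx_lambda_Delta_inj lambda : lambda != 0 ->
  injective (mulmx (invmx (lambda%:M + Deltamx p)) : 'cV_p -> 'cV_p).
Proof.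
by move=> l0; apply: can_inj => x; apply: mulKVmx; apply: lambda_Delta_unit.
Qed.

Lemma invmx_lambda_Delta_Amx lambda mu x : lambda != 0 ->
  invmx (lambda%:M + Deltamx p) *m (Amx mu *m x) =
    Amx mu *m (invmx (lambda%:M + Deltamx p) *m x) +
    invmx (lambda%:M + Deltamx p) *m (invmx (lambda%:M + Deltamx p) *m x).
Proof.
move=> l0; set V := invmx _; have uL := lambda_Delta_unit l0.
rewrite -[x in LHS](mulKVmx uL) -/V; set y := V *m x.
have -> : Amx mu *m ((lambda%:M + Deltamx p) *m y) =
    (lambda%:M + Deltamx p) *m (Amx mu *m y) + y.
  rewrite -[X in _ = _ + X]mul1mx -(Amx_Delta_weyl p_pr lambda mu).
  by rewrite mulmxBl !mulmxA [RHS]addrC subrK.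
by rewrite mulmxDr mulKmx.
Qed.

Lemma AffA_latin lambda mu (mu0 : mu != 0) c :
  lambda != 0 -> latin (AffA lambda mu mu0 c).
Proof. by move=> l0; apply/Aff_latin/invmx_lambda_Delta_inj. Qed.

Lemma AffA_cycle_set lambda mu (mu0 : mu != 0) c :
  lambda != 0 -> cycle_set (AffA lambda mu mu0 c).
Proof.
move=> l0; apply: Aff_cycle_set; first exact: invmx_lambda_Delta_inj.
by move=> x; apply: invmx_lambda_Delta_Amx.
Qed.

(** The class of 0 is a subspace stable under A_mu and (lambda I + Delta)^-1, hence by finiteness
    under lambda I + Delta and so under Delta; irreducibility makes it zero or everything. *)
Lemma AffA_simple lambda mu (mu0 : mu != 0) c :
  lambda != 0 -> simple_lq (AffA lambda mu mu0 c).
Proof.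
move=> l0; split; first exact/latin_indecomposable/AffA_latin.
move=> R congR; have phi_inj := invmx_lambda_Delta_inj l0.
have Rsub := Aff_congruence_sub congR phi_inj.
have Radd := Aff_congruence_add congR phi_inj.
have Rpsi := Aff_congruence_psi congR phi_inj.
have Rphi := Aff_congruence_phi congR phi_inj.
have R0 : R 0 0 by case: congR => eqR _ _; have [] := eqR 0 0 0.
have [/existsP[w /andP[w0 Rw]]|/existsPn Rid] :=
  boolP [exists w : 'cV['F_p]_p, (w != 0) && R w 0]; last first.
  left=> x y; rewrite Rsub -subr_eq0; apply/idP/eqP => [Rxy|-> //].
  by have := Rid (x - y); rewrite Rxy andbT negbK => /eqP.
have RL x : R x 0 -> R ((lambda%:M + Deltamx p) *m x) 0.
  pose P (z : 'cV_p) := R z 0.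
  move=> Rx; apply: (injective_preim_closed (P := P) phi_inj) => //.
  by rewrite /P mulKmx // lambda_Delta_unit.
have RZ a x : R x 0 -> R (a *: x) 0.
  move=> Rx; rewrite cV_Fp_scale; elim: (a : nat) => // n IHn.
  by rewrite mulrS Radd.
right=> x y; rewrite Rsub.
apply: (invariant_full p_pr (S := fun z => R z 0) R0 Radd _ Rpsi Rw w0).
move=> {}x Rx.
have -> : Deltamx p *m x =
    (lambda%:M + Deltamx p) *m x + (- lambda) *: x.
  by rewrite mulmxDl mul_scalar_mx scaleNr addrAC subrr add0r.
by rewrite Radd ?RL ?RZ.
Qed.

Lemma AffA_affine_simple lambda mu (mu0 : mu != 0) c :
  lambda != 0 -> affine_simple_latin_cycle_set (p ^ p)%N (AffA lambda mu mu0 c).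
Proof.
move=> l0; split.
- exists 'cV['F_p]_p, (mulmx (invmx (lambda%:M + Deltamx p))).
  exists (mulmx (Amx mu)), c.
  by exists (Amx_bij mu0), id => //; exists id.
- exact: AffA_simple.
- exact: AffA_latin.
- exact: AffA_cycle_set.
- by rewrite /= card_mx muln1 card_Fp.
Qed.

(** With L = lambda I + Delta, the relation A_mu L = L A_mu + 1 shows that L conjugates 1 - phi -
    psi into 1 - A_mu. *)
Lemma lambda_Delta_sub lambda mu x : lambda != 0 ->
  (lambda%:M + Deltamx p) *m
    (x - (invmx (lambda%:M + Deltamx p) *m x + Amx mu *m x)) =
  (lambda%:M + Deltamx p) *m x - Amx mu *m ((lambda%:M + Deltamx p) *m x).
Proof.
move=> l0; have uL := lambda_Delta_unit l0.
rewrite mulmxBr mulmxDr (mulKVmx uL); congr (_ - _).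
rewrite -[X in X + _]mul1mx -(Amx_Delta_weyl p_pr lambda mu) mulmxBl.
by rewrite !mulmxA subrK.
Qed.

(** The isomorphism is x -> b x + w with w = L^-1 y: it requires (1 - phi - psi) w = c' - b c, which
    L turns into the equation on [y]. *)
Lemma AffA_change_constant lambda mu (mu0 : mu != 0) c c' (b : 'F_p) y :
    lambda != 0 -> b != 0 ->
    y - Amx mu *m y = (lambda%:M + Deltamx p) *m (c' - b *: c) ->
  isomorphic (AffA lambda mu mu0 c) (AffA lambda mu mu0 c').
Proof.
move=> l0 b0; set L := lambda%:M + _ => y_def.
have uL : L \in unitmx := lambda_Delta_unit l0.
apply: (@Aff_isomorphic _ _ _ _ _ _ _ _ _ _ (fun x => b *: x) (invmx L *m y)).
- by exists (fun x => b^-1 *: x) => x; rewrite scalerA ?mulVf ?mulfV ?scale1r.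
- by move=> x x'; rewrite scalerDr.
- by move=> x; rewrite /= -scalemxAr.
- by move=> x; rewrite /= -scalemxAr.
have := lambda_Delta_sub mu (invmx L *m y) l0; rewrite -/L mulKVmx // y_def.
move/(can_inj (mulKmx uL)) => /eqP; rewrite subr_eq => /eqP {1}->.
by rewrite addrA [b *: c + _]addrC subrK [LHS]addrC.
Qed.

Lemma mulmx_lambda_Delta_e1 lambda :
  (lambda%:M + Deltamx p) *m e1 p = lambda *: e1 p.
Proof.
rewrite mulmxDl mul_scalar_mx (_ : e1 p = stdcol p 0) //.
by rewrite Deltamx_stdcol0 // addr0.
Qed.

Lemma AffA_normal_constant lambda mu (mu0 : mu != 0) c : lambda != 0 ->
  isomorphic (AffA lambda mu mu0 c) (AffA lambda mu mu0 0) \/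
  mu = 1 /\ isomorphic (AffA lambda mu mu0 c) (AffA lambda mu mu0 (e1 p)).
Proof.
move=> l0; pose L := lambda%:M + Deltamx p.
pose s := \sum_i (L *m c) i 0.
have solve (c' : 'cV['F_p]_p) b t :
    b != 0 -> (1 - mu) * t = mu * \sum_i (L *m (c' - b *: c)) i 0 ->
    isomorphic (AffA lambda mu mu0 c) (AffA lambda mu mu0 c').
  move=> b0 /(Amx_solve p_pr)[y y_def].
  exact: AffA_change_constant l0 b0 y_def.
have sum0 : \sum_i (L *m (0 - 1 *: c)) i 0 = - s.
  by rewrite scale1r sub0r mulmxN -sumrN; apply: eq_bigr => i _; rewrite mxE.
have [mu1|mu_n1] := eqVneq mu 1; last first.
  left; apply: (solve 0 1 ((1 - mu)^-1 * (mu * - s))); first exact: oner_neq0.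
  by rewrite sum0 mulVKf // subr_eq0 eq_sym.
have [s0|s_n0] := eqVneq s 0.
  left; apply: (solve 0 1 0); first exact: oner_neq0.
  by rewrite sum0 s0 oppr0 !mulr0.
(* For mu = 1 the coordinate sum of L (e1 - b c), equal to lambda - b s, must vanish; this dictates
   b. *)
right; split=> //; apply: (solve (e1 p) (lambda / s) 0).
  by rewrite mulf_neq0 ?invr_eq0.
rewrite mulr0 mulmxBr mulmx_lambda_Delta_e1 -scalemxAr.
rewrite (eq_bigr (fun i => lambda * e1 p i 0 - lambda / s * (L *m c) i 0)).
  rewrite sumrB -!mulr_sumr -/s divfK // (bigD1 (Ordinal p_gt0)) //= big1.
    by rewrite mxE eqxx addr0 mulr1 subrr mulr0.
  by move=> i i0; rewrite mxE -[_ == 0%N]/(i == Ordinal p_gt0) (negPf i0).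
by move=> i _; rewrite !mxE.
Qed.

(** The linear part M of an isomorphism makes M e1 a vector with Delta M e1 = (lambda - lambda') M
    e1, and Delta is nilpotent. Comparing p-th powers of A_mu and A_mu' gives mu = mu'. *)
Lemma AffA_isomorphic_inj lambda mu (mu0 : mu != 0) c
    lambda' mu' (mu'0 : mu' != 0) c' :
    lambda != 0 -> lambda' != 0 ->
    isomorphic (AffA lambda mu mu0 c) (AffA lambda' mu' mu'0 c') ->
  lambda = lambda' /\ mu = mu'.
Proof.
move=> l0 l'0 /(Aff_isomorphic_additive (invmx_lambda_Delta_inj l0)).
case=> h [h_bij hD hphi hpsi]; have [M hM] := additive_mx hD.
have Me0 : M *m e1 p != 0.
  rewrite -hM -(mulmx0 _ M) -hM (inj_eq (bij_inj h_bij)).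
  exact: stdcol_neq0.
split; apply/eqP; rewrite -subr_eq0; apply/negPn/negP => d0; case/eqP: Me0.
  apply: (Deltamx_eigen p_pr d0).
  have uL := lambda_Delta_unit l0; have uL' := lambda_Delta_unit l'0.
  have := hphi ((lambda%:M + Deltamx p) *m e1 p).
  rewrite /= mulKmx // mulmx_lambda_Delta_e1 !hM.
  move/(congr1 (mulmx (lambda'%:M + Deltamx p))).
  rewrite mulKVmx // -scalemxAr mulmxDl mul_scalar_mx => /(canRL (addKr _)) ->.
  by rewrite scalerBl addrC.
have iterM k : M *m iter k (mulmx (Amx mu)) (e1 p) =
    iter k (mulmx (Amx mu')) (M *m e1 p).
  by elim: k => // k IHk; rewrite !iterS -IHk -!hM hpsi.
have := iterM p; rewrite !iter_Amx // -scalemxAr => /eqP.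
by rewrite -subr_eq0 -scalerBl scaler_eq0 (negPf d0) => /eqP.
Qed.

(** For an idempotent x, y = L x satisfies y - A_1 y = lambda e1. The rows after the first make all
    entries of y equal, and the first row then reads 0 = lambda. *)
Lemma AffA_e1_not_idempotent lambda
    (x : AffA lambda 1 (oner_neq0 'F_p) (e1 p)) :
  lambda != 0 -> lq_op x x <> x.
Proof.
move=> l0; rewrite Aff_opE /= => x_def.
move: (x : 'cV['F_p]_p) x_def => {}x x_def.
pose L := lambda%:M + Deltamx p; pose y := L *m x.
have y_def : y - Amx 1 *m y = lambda *: e1 p.
  rewrite -mulmx_lambda_Delta_e1 /y -lambda_Delta_sub //; congr (_ *m _).
  by apply/eqP; rewrite subr_eq [e1 p + _]addrC x_def.
have yk k (i : 'I_p) : i = k :> nat -> y i 0 = y (Ordinal p_gt0) 0.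
  elim: k i => [|k IHk] i ik; first by congr (y _ 0); apply: val_inj.
  have lt_kp : (k < p)%N by rewrite ltnW // -ik.
  rewrite -(IHk (Ordinal lt_kp)) //; apply/eqP; rewrite -subr_eq0.
  have /colP/(_ i) := y_def; rewrite mxE [X in _ + X]mxE.
  rewrite (Amx_mulS _ _ (j := Ordinal lt_kp)) // => ->.
  by rewrite !mxE ik mulr0.
have ltp1 : (p.-1 < p)%N by rewrite prednK.
have /colP/(_ (Ordinal p_gt0)) := y_def; rewrite mxE [X in _ + X]mxE.
rewrite (Amx_mul_first _ _ (j := Ordinal ltp1)) // mul1r.
rewrite (yk _ (Ordinal ltp1) erefl).
by rewrite subrr !mxE mulr1 => /esym/eqP; apply/negP.
Qed.

End AffA.

(** * Classification and count *)

Lemma affine_simple_latin_classification (p : nat) (X : leftQuasigroup) :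
    prime p -> affine_simple_latin_cycle_set (p ^ p)%N X ->
  exists (lambda mu : 'F_p) (mu0 : mu != 0) (c : 'cV_p),
    lambda != 0 /\ isomorphic X (AffA lambda mu mu0 c).
Proof.
move=> p_pr [[G [phi [psi [c [psi_bij XG]]]]] simX latX cycX oX].
have oG : #|G| = (p ^ p)%N.
  by case: XG => f f_bij _; rewrite -(bij_eq_card f_bij).
have phi_inj := Aff_latin_inj (isomorphic_latin XG latX).
have phipsi := Aff_cycle_set_comm (isomorphic_cycle_set XG cycX).
have pG : forall x : G, x *+ p = 0.
  apply: (Aff_simple_exponent (phi := phi) (c := c) (psi_bij := psi_bij)) => //.
    by rewrite oG -{1}(exp1n p) ltn_exp2r ?prime_gt0 ?prime_gt1.
  by move=> R; apply: isomorphic_congruence XG simX.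
have [g [[gV gK Kg] gD]] := elementary_abelian_coordinates p_pr oG pG.
have g0 : g 0 = 0 by apply: (addIr (g 0)); rewrite -gD !add0r.
have gVD : {morph gV : x y / x + y}.
  by move=> x y; rewrite -{1}(Kg x) -{1}(Kg y) -gD gK.
have gV0 : gV 0 = 0 by rewrite -g0 gK.
have [theta phiK thetaK] := injF_bij phi_inj.
have thetaD : {morph theta : x y / x + y}.
  by move=> x y; rewrite -{1}(thetaK x) -{1}(thetaK y) -raddfD phiK.
have [T T_def] : exists T : 'M['F_p]_p, forall x, gV (theta (g x)) = T *m x.
  by apply: additive_mx => x y; rewrite gD thetaD gVD.
have [U U_def] : exists U : 'M['F_p]_p, forall x, gV (psi (g x)) = U *m x.
  by apply: additive_mx => x y; rewrite gD raddfD gVD.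
have theta0 : theta 0 = 0 by rewrite -{1}(raddf0 phi) phiK.
have [|||lambda [mu [P [l0 mu0 P_inj TP UP]]]] := @weyl_normal_form p p_pr T U.
- move=> x Tx.
  apply: (can_inj gK); apply: (can_inj thetaK); apply: (can_inj Kg).
  by rewrite T_def Tx g0 theta0 gV0.
- move=> x Ux.
  apply: (can_inj gK); apply: (bij_inj psi_bij); apply: (can_inj Kg).
  by rewrite U_def Ux g0 raddf0 gV0.
(* Applying [phi] to psi theta = theta psi + 1 reduces it to the relation [phipsi]. *)
- apply: cV_ext => x; rewrite mul1mx mulmxBl -!mulmxA; apply: (can_inj gK).
  apply: (addIr (g (T *m (U *m x)))).
  rewrite -gD subrK -!U_def -!T_def !Kg; apply: phi_inj.
  by rewrite phipsi raddfD /= !thetaK addrC.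
pose h x : G := g (P *m x).
have h_inj : injective h.
  move=> x y /(can_inj gK)/eqP; rewrite -subr_eq0 -mulmxBr => /eqP/P_inj/eqP.
  by rewrite subr_eq0 => /eqP.
have [hV hK Kh] : bijective h.
  by apply: inj_card_bij => //; rewrite oG card_mx muln1 card_Fp.
exists lambda, mu, mu0, (hV c); split=> //; apply: isomorphic_trans XG _.
apply: isomorphic_sym; apply: (@Aff_isomorphic _ _ _ _ _ _ _ _ _ _ h 0).
- by exists hV.
- by move=> x y; rewrite /h mulmxDr gD.
- move=> x; apply: (can_inj thetaK); rewrite phiK /h /=.
  apply: (can_inj Kg); rewrite T_def mulmxA TP -mulmxA mulKVmx ?gK //.
  exact: lambda_Delta_unit.
- by move=> x; rewrite /h /= mulmxA -UP -mulmxA -U_def Kg.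
- by rewrite Kh !raddf0 addr0 !add0r.
Qed.

Theorem theorem57 (p : nat) (p_pr : prime p) :
  [/\ forall (lambda mu : 'F_p) (mu0 : mu != 0), lambda != 0 ->
        latin (AffA lambda mu mu0 0) /\ cycle_set (AffA lambda mu mu0 0),
      forall lambda : 'F_p, lambda != 0 ->
        latin (AffA lambda 1 (oner_neq0 'F_p) (e1 p)) /\
        cycle_set (AffA lambda 1 (oner_neq0 'F_p) (e1 p)),
      forall X : leftQuasigroup,
        affine_simple_latin_cycle_set (p ^ p)%N X ->
        (exists (lambda mu : 'F_p) (mu0 : mu != 0),
           lambda != 0 /\ isomorphic X (AffA lambda mu mu0 0)) \/
        (exists lambda : 'F_p,
           lambda != 0 /\
           isomorphic X (AffA lambda 1 (oner_neq0 'F_p) (e1 p)))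
    & number_up_to_iso (affine_simple_latin_cycle_set (p ^ p)%N)
        (p * (p - 1))%N].
Proof.
have classif X : affine_simple_latin_cycle_set (p ^ p)%N X ->
    (exists (lambda mu : 'F_p) (mu0 : mu != 0),
       lambda != 0 /\ isomorphic X (AffA lambda mu mu0 0)) \/
    (exists lambda : 'F_p,
       lambda != 0 /\ isomorphic X (AffA lambda 1 (oner_neq0 'F_p) (e1 p))).
  move/(affine_simple_latin_classification p_pr).
  move=> [lambda [mu [mu0 [c [l0 Xc]]]]].
  have [iso0|[mu1 iso1]] := AffA_normal_constant p_pr mu0 c l0.
    by left; exists lambda, mu, mu0; split=> //; apply: isomorphic_trans iso0.
  right; exists lambda; split=> //; apply: isomorphic_trans Xc _.
  by subst mu; rewrite (bool_irrelevance (oner_neq0 _) mu0).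
split=> // [lambda mu mu0 l0|lambda l0|].
- by split; [apply: AffA_latin | apply: AffA_cycle_set].
- by split; [apply: AffA_latin | apply: AffA_cycle_set].
pose nzF := {a : 'F_p | a != 0}.
(* [Some mu] stands for constant 0 and [None] for mu = 1 with constant e1, so each of the p-1 values
   of lambda carries p models. *)
pose Fam (t : nzF * option nzF) : leftQuasigroup :=
  if t.2 is Some mu then AffA (sval t.1) (sval mu) (svalP mu) 0
  else AffA (sval t.1) 1 (oner_neq0 'F_p) (e1 p).
have card_nzF : #|{: nzF}| = (p - 1)%N.
  by rewrite card_sig cardC1 card_Fp // subn1.
have card_index : (p * (p - 1))%N = #|{: nzF * option nzF}|.
  rewrite card_prod card_option card_nzF mulnC subn1 prednK //.
  exact: prime_gt0.
have Fam_inj s t : isomorphic (Fam s) (Fam t) -> s = t.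
  (* The existence of an idempotent separates constant 0 from constant e1. *)
  have idem0 (l m : 'F_p) (m0 : m != 0) :
      exists x : AffA l m m0 0, lq_op x x = x.
    by exists 0; rewrite Aff_opE !raddf0 !addr0.
  have idemE X Y : isomorphic X Y -> (exists x : X, lq_op x x = x) ->
      exists y : Y, lq_op y y = y.
    by case=> f _ fM [x xx]; exists (f x); rewrite -fM xx.
  case: s t => [[l l0] [[m m0]|]] [[l' l'0] [[m' m'0]|]] iso_st.
  - have [ll' mm'] := AffA_isomorphic_inj p_pr l0 l'0 iso_st.
    by congr (_, Some _); apply: val_inj.
  - have [x xx] := idemE _ _ iso_st (idem0 _ _ _).
    by case: (AffA_e1_not_idempotent p_pr l'0 xx).
  - have [x xx] := idemE _ _ (isomorphic_sym iso_st) (idem0 _ _ _).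
    by case: (AffA_e1_not_idempotent p_pr l0 xx).
  have [ll' _] := AffA_isomorphic_inj p_pr l0 l'0 iso_st.
  by congr (_, None); apply: val_inj.
exists (fun i => Fam (enum_val (cast_ord card_index i))); split.
- move=> i; case: (enum_val _) => [[lambda l0] [[mu mu0]|]].
    exact: AffA_affine_simple.
  exact: AffA_affine_simple.
- by move=> i j /Fam_inj/enum_val_inj/cast_ord_inj.
move=> X /classif[[lambda [mu [mu0 [l0 isoX]]]]|[lambda [l0 isoX]]].
  pose t : nzF * option nzF := (exist _ lambda l0, Some (exist _ mu mu0)).
  exists (cast_ord (esym card_index) (enum_rank t)).
  by rewrite cast_ordKV enum_rankK.
pose t : nzF * option nzF := (exist _ lambda l0, None).
exists (cast_ord (esym card_index) (enum_rank t)).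
by rewrite cast_ordKV enum_rankK.
Qed.
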